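(* Let $\vdash$ be a nontrivial logic with a theorem $\varphi$ such that $\mathrm{Var}(\varphi)\neq\emptyset$. The following are equivalent: (i) $\vdash$ has an algebraic semantics; (ii) either $\vdash$ is assertional and graph-based, or $\vdash$ is not graph-based and there are two distinct formulas $\epsilon,\delta$, logically equivalent in $\vdash$, with $\mathrm{Var}(\epsilon)\cup\mathrm{Var}(\delta)=\{x\}$; (iii) either $\vdash$ is assertional and graph-based, or $\vdash$ is not graph-based and $\mathsf{Alg}(\vdash)\vDash\epsilon\approx\delta$ for some nontrivial equation $\epsilon\approx\delta$ with $\mathrm{Var}(\epsilon)\cup\mathrm{Var}(\delta)=\{x\}$; (iv) either $\vdash$ is assertional and graph-based, or $\vdash$ is not graph-based and has a matrix semantics validating a nontrivial equation $\epsilon\approx\delta$ with $\mathrm{Var}(\epsilon)\cup\mathrm{Var}(\delta)=\{x\}$.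
   Context: A logic $\vdash$ is a substitution-invariant consequence relation on the set $Fm$ of formulas, over a denumerable set of variables, of an algebraic language $\mathscr{L}_\vdash$. A theorem is a formula $\varphi$ with $\emptyset\vdash\varphi$. $\vdash$ is trivial if $x\vdash y$ for distinct variables $x,y$, and nontrivial otherwise. $\mathrm{Var}(\varphi)$ is the set of variables occurring in $\varphi$; an equation $\epsilon\approx\delta$ is nontrivial if $\epsilon\neq\delta$ as formulas. Formulas $\epsilon,\delta$ are logically equivalent in $\vdash$ if $\gamma(\epsilon,\vec z)\dashv\vdash\gamma(\delta,\vec z)$ for every formula $\gamma(v,\vec z)$. A language/logic is graph-based if all connectives have arity $\le1$ and there is at most one unary connective. A matrix is a pair $\langle\boldsymbol A,F\rangle$ with $F\subseteq A$; the logic induced by a class $\mathsf M$ of matrices: $\Gamma\vdash_{\mathsf M}\varphi$ iff for all $\langle\boldsymbol A,F\rangle\in\mathsf M$ and homomorphisms $h\colon\boldsymbol{Fm}\to\boldsymbol A$, $h[\Gamma]\subseteq F$ implies $h(\varphi)\in F$; $\mathsf M$ is a matrix semantics of $\vdash$ if $\vdash=\vdash_{\mathsf M}$; $\mathsf M$ validates an equation if all algebras $\boldsymbol A$ of its matrices do. $\vdash$ is assertional if it is induced by a class $\mathsf M$ of matrices for which there is a formula $\psi(x)$ such that, for every $\langle\boldsymbol A,F\rangle\in\mathsf M$, the term function $\psi^{\boldsymbol A}$ is constant and $F=\{\psi^{\boldsymbol A}\}$. For an $\mathscr{L}_\vdash$-algebra $\boldsymbol A$, a set $F\subseteq A$ is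 a deductive filter of $\vdash$ on $\boldsymbol A$ if for all $\Gamma\vdash\varphi$ and homomorphisms $h\colon\boldsymbol{Fm}\to\boldsymbol A$, $h[\Gamma]\subseteq F$ implies $h(\varphi)\in F$; $\mathrm{Fg}^{\boldsymbol A}_\vdash(X)$ is the least deductive filter containing $X$. Let $a\equiv^{\boldsymbol A}_\vdash c$ iff $\mathrm{Fg}^{\boldsymbol A}_\vdash(p(a))=\mathrm{Fg}^{\boldsymbol A}_\vdash(p(c))$ for every unary polynomial function $p$ of $\boldsymbol A$; $\mathsf{Alg}(\vdash)$ is the class of $\mathscr L_\vdash$-algebras on which $\equiv^{\boldsymbol A}_\vdash$ is the identity. A logic has an algebraic semantics if there are a set of equations $\boldsymbol\tau(x)$ in one variable and a class $\mathsf K$ of $\mathscr L_\vdash$-algebras with $\Gamma\vdash\varphi$ iff $\boldsymbol\tau[\Gamma]\vDash_{\mathsf K}\boldsymbol\tau(\varphi)$, where $\boldsymbol\tau[\Gamma]$ collects the instances of $\boldsymbol\tau$ with $x$ replaced by members of $\Gamma$ and $\vDash_{\mathsf K}$ is equational consequence relative to $\mathsf K$. *)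

(* Defs.v *)
From mathcomp Require Import all_boot.
From mathcomp Require Import boolp classical_sets.

Set Implicit Arguments.
Unset Strict Implicit.
Unset Printing Implicit Defensive.

Local Open Scope classical_set_scope.

Record language := Language {
  symb : Type;
  arity : symb -> nat
}.

(* The variables are indexed by nat; [Var 0] and [Var 1] play the roles of the
   variables x and y. Arguments of a connective are functions out of 'I_n, so
   that identity of formulas is Leibniz equality (with functional
   extensionality). *)
Inductive Fm (L : language) : Type :=
| Var of nat
| App (f : symb L) of ('I_(arity f) -> Fm L).

Arguments Var {L} n.
Arguments App {L} f args.

Fixpoint vars (L : language) (phi : Fm L) : set nat :=
  match phi with
  | Var n => [set n]
  | App f args => \bigcup_(i in [set: 'I_(arity f)]) vars (args i)
  end.

Record algebra (L : language) := Algebra {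
  carrier :> Type;
  interp : forall f : symb L, ('I_(arity f) -> carrier) -> carrier;
  carrier_nonempty : inhabited carrier
}.

Arguments interp {L a} f args.

Definition FmAlg (L : language) : algebra L :=
  @Algebra L (Fm L) (@App L) (inhabits (Var 0)).

Definition is_hom (L : language) (A B : algebra L) (h : A -> B) : Prop :=
  forall (f : symb L) (args : 'I_(arity f) -> A),
    h (interp f args) = interp f (fun i => h (args i)).

Fixpoint eval (L : language) (A : algebra L) (e : nat -> A) (phi : Fm L) : A :=
  match phi with
  | Var n => e n
  | App f args => interp f (fun i => eval e (args i))
  end.

(* phi[v := eps], all variables other than v being left unchanged *)
Definition subst1 (L : language) (v : nat) (eps phi : Fm L) : Fm L :=
  @eval L (FmAlg L) (fun n => if n == v then eps else Var n) phi.

(* Monotonicity of a consequence relation follows from reflexivity and cut. *)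
Record logic (L : language) := Logic {
  entails :> set (Fm L) -> Fm L -> Prop;
  entails_refl : forall (Gamma : set (Fm L)) (phi : Fm L),
    Gamma phi -> entails Gamma phi;
  entails_cut : forall (Gamma Delta : set (Fm L)) (phi : Fm L),
    (forall delta, Delta delta -> entails Gamma delta) ->
    entails Delta phi -> entails Gamma phi;
  entails_subst : forall (Gamma : set (Fm L)) (phi : Fm L)
      (sigma : Fm L -> Fm L),
    @is_hom L (FmAlg L) (FmAlg L) sigma ->
    entails Gamma phi -> entails (sigma @` Gamma) (sigma phi)
}.

Section Notions.
Variable L : language.
Implicit Types (D : logic L) (A : algebra L) (phi psi eps delta : Fm L).

Definition theorem D phi : Prop := D set0 phi.

Definition trivial D : Prop := D [set Var 0] (Var 1).

Definition logically_equivalent D eps delta : Prop :=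
  forall (gamma : Fm L) (v : nat),
    D [set subst1 v eps gamma] (subst1 v delta gamma) /\
    D [set subst1 v delta gamma] (subst1 v eps gamma).

Definition graph_based : Prop :=
  (forall f : symb L, arity f <= 1) /\
  (forall f g : symb L, arity f = 1 -> arity g = 1 -> f = g).

Definition validates A eps delta : Prop :=
  forall h : Fm L -> A, @is_hom L (FmAlg L) A h -> h eps = h delta.

(* Classes of matrices and of algebras are predicates rather than [set]s, whose
   universe is too small to contain them. *)
Record matrix := Matrix {
  matrix_alg :> algebra L;
  designated : set matrix_alg
}.

Definition matrix_consequence (M : matrix -> Prop)
    (Gamma : set (Fm L)) phi : Prop :=
  forall (m : matrix), M m ->
  forall h : Fm L -> m, @is_hom L (FmAlg L) m h ->
    h @` Gamma `<=` @designated m -> @designated m (h phi).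

Definition matrix_semantics D (M : matrix -> Prop) : Prop :=
  forall (Gamma : set (Fm L)) phi,
    D Gamma phi <-> matrix_consequence M Gamma phi.

(* the value at a of the term function of a formula psi(x) *)
Definition term_fun A psi (a : A) : A := eval (fun _ => a) psi.

Definition assertional D : Prop :=
  exists M : matrix -> Prop, matrix_semantics D M /\
  exists psi : Fm L, vars psi `<=` [set 0] /\
    forall m : matrix, M m ->
      exists c : m,
        (forall a : m, term_fun psi a = c) /\ @designated m = [set c].

Definition deductive_filter D A (F : set A) : Prop :=
  forall (Gamma : set (Fm L)) phi, D Gamma phi ->
  forall h : Fm L -> A, @is_hom L (FmAlg L) A h ->
    h @` Gamma `<=` F -> F (h phi).

Definition Fg D A (X : set A) : set A := smallest (@deductive_filter D A) X.

(* a |-> t(a, c_1, c_2, ...), the parameters c_n being given by e *)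
Definition unary_polynomial A (p : A -> A) : Prop :=
  exists (t : Fm L) (e : nat -> A),
    forall a : A, p a = eval (fun n => if n == 0 then a else e n) t.

Definition filter_equiv D A (a c : A) : Prop :=
  forall p : A -> A, unary_polynomial p -> Fg D [set p a] = Fg D [set p c].

Definition Alg D : algebra L -> Prop :=
  fun A => forall a c : A, filter_equiv D a c -> a = c.

Definition equation := (Fm L * Fm L)%type.

Definition equational_consequence (K : algebra L -> Prop)
    (Theta : set equation) (e : equation) : Prop :=
  forall A : algebra L, K A ->
  forall h : Fm L -> A, @is_hom L (FmAlg L) A h ->
    (forall e', Theta e' -> h e'.1 = h e'.2) -> h e.1 = h e.2.

(* tau(phi), for a set tau(x) of equations *)
Definition instance (tau : set equation) phi : set equation :=
  [set (subst1 0 phi e.1, subst1 0 phi e.2) | e in tau].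

Definition has_algebraic_semantics D : Prop :=
  exists (tau : set equation) (K : algebra L -> Prop),
    (forall e, tau e -> vars e.1 `|` vars e.2 `<=` [set 0]) /\
    forall (Gamma : set (Fm L)) phi,
      D Gamma phi <->
      (forall e, instance tau phi e ->
         equational_consequence K
           (\bigcup_(gamma in Gamma) instance tau gamma) e).

End Notions.

(* Main.v *)
Require Import Defs.
From mathcomp Require Import all_boot zify.
From mathcomp Require Import boolp classical_sets.

Set Implicit Arguments.
Unset Strict Implicit.
Unset Printing Implicit Defensive.

Local Open Scope classical_set_scope.

(** A logic has an algebraic semantics with defining equations [tau] iff it is
    induced by matrices whose designated sets are the solution sets of [tau].

    (i) to (ii): some equation [e1 = e2] of [tau] is nontrivial and contains x,
    by nontriviality of the logic. It is solved by all values of the theorem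
    phi(x), so e1(phi(x)) and e2(phi(x)) are equal in the semantics. In the
    graph-based case the only nonconstant polynomials are the powers of one
    operation, which commute with the terms of [tau]; hence polynomials do not
    distinguish designated elements, and after Leibniz reduction a single
    designated element remains.

    (iii) to (iv): the reduced Lindenbaum matrices have algebras in Alg.

    (iv) to (i): from the given equation one derives another one, eps = delta,
    such that no instance of eps is an instance of a proper nonvariable
    subformula of eps or of a nonvariable subformula of delta. For a theory T
    redefine the operations of the algebra of formulas so that an output eps(b)
    with b in T is replaced by delta(b). Non-overlapping makes T the solution
    set of eps = delta, and the modified operations agree with the original
    ones up to formulas that are equal in the given semantics. If f has arity at
    least 2, take eps = f(e(x), r(x), ..., r(x)) with r a complete f-tree higher
    than e and d. If f, g are distinct unary connectives, take
    eps = f^N g e(a g x) with N large and a in {f, g} chosen so that e(a g x)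
    and d(a g x) have no common instance. *)

(** * Formulas, evaluations and heights *)

Section Formulas.
Variable L : language.
Implicit Types (A : algebra L) (t u b : Fm L).

Lemma eval_is_hom A (e : nat -> A) : @is_hom L (FmAlg L) A (eval e).
Proof. by []. Qed.

Lemma hom_eval A (h : Fm L -> A) :
  @is_hom L (FmAlg L) A h -> forall t, h t = eval (fun n => h (Var n)) t.
Proof.
move=> hh; elim=> [n //|f args IH] /=.
by rewrite (hh f args); congr interp; apply: funext => i; apply: IH.
Qed.

Lemma eq_in_eval A (e e' : nat -> A) t :
  (forall n, vars t n -> e n = e' n) -> eval e t = eval e' t.
Proof.
elim: t => [n|f args IH] /= ee'; first exact: ee'.
congr interp; apply: funext => i; apply: IH => n tn; apply: ee'.
by exists i.
Qed.

Lemma eq_eval A (e e' : nat -> A) t : e =1 e' -> eval e t = eval e' t.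
Proof. by move=> ee'; apply: eq_in_eval. Qed.

Lemma eval_comp A (e : nat -> A) (s : nat -> Fm L) t :
  eval e (@eval L (FmAlg L) s t) = eval (fun n => eval e (s n)) t.
Proof.
elim: t => [n //|f args IH] /=.
by congr interp; apply: funext => i; apply: IH.
Qed.

Lemma eval_subst1 A (e : nat -> A) v u t :
  eval e (subst1 v u t) = eval (fun n => if n == v then eval e u else e n) t.
Proof.
by rewrite /subst1 eval_comp; apply: eq_eval => n; case: ifP.
Qed.

Lemma vars_eval (s : nat -> Fm L) t :
  vars (@eval L (FmAlg L) s t) = \bigcup_(n in vars t) vars (s n).
Proof.
elim: t => [n|f args IH] /=; first by rewrite bigcup_set1.
apply/seteqP; split=> k.
  by case=> i _; rewrite IH => -[n ni sn]; exists n => //; exists i.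
by case=> n [i _ ni] sn; exists i => //; rewrite IH; exists n.
Qed.

Definition plug t b : Fm L := @eval L (FmAlg L) (fun _ => b) t.

Lemma eval_plug A (e : nat -> A) t b :
  eval e (plug t b) = term_fun t (eval e b).
Proof. exact: eval_comp. Qed.

Lemma plug_plug t u b : plug (plug t u) b = plug t (plug u b).
Proof. exact: (@eval_plug (FmAlg L)). Qed.

Lemma vars_plug t b : vars t !=set0 -> vars (plug t b) = vars b.
Proof.
rewrite /plug vars_eval => -[n tn]; apply/seteqP; split=> k; first by case.
by move=> bk; exists n.
Qed.

Lemma vars_plug_sub t b : vars (plug t b) `<=` vars b.
Proof. by rewrite /plug vars_eval => k []. Qed.

Lemma eval_Var t : @eval L (FmAlg L) Var t = t.
Proof.
elim: t => [n //|f args IH] /=.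
by congr App; apply: funext => i; apply: IH.
Qed.

Lemma plug_closed t b : vars t = set0 -> plug t b = t.
Proof.
move=> t0; rewrite -[RHS]eval_Var; apply: (@eq_in_eval (FmAlg L)) => n.
by rewrite t0.
Qed.

Definition is_var t := if t is Var _ then true else false.

Definition root_symb t : option (symb L) := if t is App f _ then Some f else None.

(* The projections [arg k] allow one to invert equalities of formulas without
   inverting equalities of dependent pairs. *)
Definition arg k t : Fm L :=
  if t is App f args then if insub k is Some i then args i else t else t.

Lemma arg_App f (args : 'I_(arity f) -> Fm L) (i : 'I_(arity f)) :
  arg i (App f args) = args i.
Proof. by rewrite /= valK. Qed.

Lemma App_inj f (x y : 'I_(arity f) -> Fm L) :
  App f x = App f y -> x =1 y.
Proof. by move=> xy i; rewrite -(arg_App x) -(arg_App y) xy. Qed.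

Fixpoint height t : nat :=
  match t with
  | Var _ => 0
  | App f args => (\max_(i < arity f) height (args i)).+1
  end.

Lemma height_arg f (args : 'I_(arity f) -> Fm L) i :
  height (args i) < height (App f args).
Proof. by rewrite /= ltnS (leq_bigmax i). Qed.

Lemma height_App_le f (args : 'I_(arity f) -> Fm L) k :
  (forall i, height (args i) <= k) -> height (App f args) <= k.+1.
Proof. by move=> hk; rewrite /= ltnS; apply/bigmax_leqP => i _. Qed.

Lemma height_plug_le t b : height (plug t b) <= height t + height b.
Proof.
elim: t => [n //|f args IH].
apply: (@height_App_le f (fun i => plug (args i) b)) => i.
by apply: leq_trans (IH i) _; rewrite leq_add2r -ltnS; apply: height_arg.
Qed.

Lemma height_le_plug t b : height t <= height (plug t b).
Proof.
elim: t => [n //|f args IH].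
apply: height_App_le => i; apply: leq_trans (IH i) _.
by rewrite -ltnS; apply: (@height_arg f (fun i => plug (args i) b)).
Qed.

Lemma height_plug_ge t b : vars t !=set0 -> height b <= height (plug t b).
Proof.
elim: t => [n //|f args IH] [n [i _ ni]].
apply: leq_trans (IH i _) _; first by exists n.
by apply: ltnW; apply: (@height_arg f (fun i => plug (args i) b)).
Qed.

Lemma height_plug_gt t b :
  ~~ is_var t -> vars t !=set0 -> height b < height (plug t b).
Proof.
case: t => [n //|f args] _ [n [i _ ni]].
apply: leq_ltn_trans (@height_plug_ge (args i) b _) _; first by exists n.
exact: (@height_arg f (fun i => plug (args i) b)).
Qed.

Lemma plug_injr t b b' : vars t !=set0 -> plug t b = plug t b' -> b = b'.
Proof.
elim: t => [n //|f args IH] [n [i _ ni]] eqb.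
by apply: (IH i); [exists n|apply: (App_inj eqb i)].
Qed.

Lemma vars0_or t : vars t = set0 \/ vars t !=set0.
Proof. by have [->|/set0P] := eqVneq (vars t) set0; [left|right]. Qed.

(** A variable in t makes [plug t b] higher than b; without variables [plug t b] is t itself. *)
Lemma plug_neq_arg t b :
  ~~ is_var t -> (vars t = set0 -> t <> b) -> plug t b <> b.
Proof.
move=> nv t0 eqb; have [c|v] := vars0_or t.
  by apply: t0 => //; rewrite -eqb plug_closed.
by have := height_plug_gt b nv v; rewrite eqb ltnn.
Qed.

(** With equal instances, t and t' can differ only where a variable of one meets a nonvariable
    subformula u of the other. Then [plug u b] is b, so u is closed and equal to b, which the first
    hypothesis excludes. *)
Lemma plug_injl N b t t' :
  (forall u, vars u = set0 -> height u <= N -> u <> b) ->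
  vars t `<=` [set 0] -> vars t' `<=` [set 0] ->
  height t <= N -> height t' <= N ->
  plug t b = plug t' b -> t = t'.
Proof.
move=> hb; elim: t t' => [n|f args IH] [n'|f' args'] vt vt' ht ht' eqb.
- have -> : n = 0 := vt n erefl.
  by have -> : n' = 0 := vt' n' erefl.
- case: (@plug_neq_arg (App f' args') b) => // c; exact: hb c ht'.
- case: (@plug_neq_arg (App f args) b) => // c; exact: hb c ht.
have [ff'] : Some f = Some f' := congr1 root_symb eqb.
move: args' vt' ht' eqb; rewrite -ff' => args' vt' ht' eqb.
congr App; apply: funext => i; apply: IH.
- by move=> n ni; apply: vt; exists i.
- by move=> n ni; apply: vt'; exists i.
- by apply: leq_trans ht; apply/ltnW/height_arg.
- by apply: leq_trans ht'; apply/ltnW/height_arg.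
- exact: (App_inj eqb i).
Qed.

End Formulas.

(** * Leibniz reduction of matrices *)

Section Polynomials.
Variables (L : language) (A : algebra L).
Implicit Types p : A -> A.

Lemma unary_polynomial_id : unary_polynomial (fun a : A => a).
Proof.
have [a0] := carrier_nonempty A.
by exists (Var 0), (fun _ => a0) => a.
Qed.

(* The parameters of the polynomial are moved to the even variables and those
   of the operation are put on the odd ones. *)
Lemma unary_polynomial_comp p (f : symb L) (x : 'I_(arity f) -> A) k :
  unary_polynomial p ->
  unary_polynomial (fun a => p (interp f (fun i => if i == k then a else x i))).
Proof.
move=> [t [e pE]].
pose s n : Fm L :=
  if n == 0 then App f (fun i => if i == k then Var 0 else Var i.*2.+1)
  else Var n.*2.
pose e' n := if odd n then if insub n./2 is Some i then x i else e 0
             else e n./2.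
exists (@eval L (FmAlg L) s t), e' => a.
rewrite pE eval_comp; apply: eq_eval => n; rewrite /s.
case: (eqVneq n 0) => [n0|n0] /=.
  congr interp; apply: funext => i; case: ifP => //= _.
  by rewrite /e' /= odd_double /= uphalf_double valK.
by rewrite double_eq0 (negbTE n0) /e' odd_double doubleK.
Qed.

End Polynomials.

Section Reduction.
Variables (L : language) (m : matrix L).
Implicit Types a b c : m.

(** The Leibniz congruence of the matrix, described by unary polynomials. *)
Definition leibniz a b : Prop :=
  forall p : m -> m, unary_polynomial p -> designated (p a) <-> designated (p b).

Lemma leibniz_refl a : leibniz a a.
Proof. by []. Qed.

Lemma leibniz_sym a b : leibniz a b -> leibniz b a.
Proof. by move=> ab p /ab[? ?]; split. Qed.

Lemma leibniz_trans a b c : leibniz a b -> leibniz b c -> leibniz a c.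
Proof. by move=> ab bc p pp; apply: iff_trans (ab p pp) (bc p pp). Qed.

Lemma leibniz_designated a b : leibniz a b -> designated a <-> designated b.
Proof. by apply; apply: unary_polynomial_id. Qed.

Lemma leibniz_interp (f : symb L) (x y : 'I_(arity f) -> m) :
  (forall i, leibniz (x i) (y i)) -> leibniz (interp f x) (interp f y).
Proof.
(* A polynomial varies a single argument, so the arguments are exchanged one by one; [mix k] has
   exchanged the first k. *)
move=> xy; pose mix k (i : 'I_(arity f)) := if i < k then y i else x i.
have -> : y = mix (arity f) by apply: funext => i; rewrite /mix ltn_ord.
elim: (X in mix X) => [|k IH].
  by rewrite (_ : mix 0 = x)//; apply: funext => i.
apply: leibniz_trans IH _.
case: (ltnP k (arity f)) => kf; last first.
  rewrite (_ : mix k.+1 = mix k)//; apply: funext => i.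
  by rewrite /mix !(leq_trans (ltn_ord i)) // leqW.
move=> p pp; pose i0 := Ordinal kf.
have /(xy i0) := unary_polynomial_comp (mix k) i0 pp.
congr (designated (p (interp f _)) <-> designated (p (interp f _)));
  apply: funext => i; rewrite /mix ?ltnS.
- by case: eqVneq => [->|//]; rewrite /= ltnn.
- case: (eqVneq i i0) => [->|/eqP ii0]; first by rewrite leqnn.
  rewrite [i <= k]leq_eqVlt; case: eqVneq => // ik.
  by case: ii0; apply: val_inj.
Qed.

(** Classes are predicates, so that their equality follows by extensionality. *)
Definition quotient := {X : m -> Prop | exists a, X = leibniz a}.

Definition proj a : quotient := exist _ (leibniz a) (ex_intro _ a erefl).

Definition crepr (X : quotient) : m := sval (cid (svalP X)).

Lemma proj_eq a b : proj a = proj b <-> leibniz a b.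
Proof.
split=> [/(congr1 sval) /= E|ab]; first by rewrite E; apply: leibniz_refl.
apply: eq_exist; apply: funext => c; apply: propext; split.
  by apply: leibniz_trans; apply: leibniz_sym.
exact: leibniz_trans.
Qed.

Lemma creprK X : proj (crepr X) = X.
Proof.
rewrite /crepr; case: cid => a /= E; case: X E => X ? /= E.
by apply: eq_exist; rewrite E.
Qed.

Lemma leibniz_crepr a : leibniz (crepr (proj a)) a.
Proof. by apply/proj_eq; rewrite creprK. Qed.

Definition quotient_algebra : algebra L :=
  @Algebra L quotient (fun f x => proj (interp f (fun i => crepr (x i))))
    (let: inhabits a := carrier_nonempty m in inhabits (proj a)).

Definition reduction : matrix L :=
  @Matrix L quotient_algebra (fun X => designated (crepr X)).

Lemma proj_is_hom : @is_hom L m reduction proj.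
Proof.
move=> f x /=; apply/proj_eq/leibniz_interp => i.
by apply: leibniz_sym; apply: leibniz_crepr.
Qed.

Lemma proj_eval (e : nat -> m) t :
  proj (eval e t) = @eval L reduction (fun n => proj (e n)) t.
Proof.
elim: t => [n //|f args IH] /=.
rewrite [LHS](proj_is_hom _).
by congr (@interp L reduction); apply: funext => i; apply: IH.
Qed.

Lemma designated_proj a : @designated L reduction (proj a) <-> designated a.
Proof. exact/leibniz_designated/leibniz_crepr. Qed.

(** [proj] is a homomorphism that preserves and reflects designation, and valuations lift along it
    through [crepr]. The class [eq m] consists of m alone. *)
Lemma reduction_consequence Gamma phi :
  matrix_consequence (eq m) Gamma phi <->
  matrix_consequence (eq reduction) Gamma phi.
Proof.
split=> H _ <- h hh hG.
  pose g : Fm L -> m := eval (fun n => crepr (h (Var n))).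
  have gE t : proj (g t) = h t.
    rewrite proj_eval (hom_eval hh); apply: (@eq_eval _ reduction) => n; exact: creprK.
  rewrite -gE; apply/designated_proj; apply: H => //.
  by move=> _ [t Gt <-]; apply/designated_proj; rewrite gE; apply: hG; exists t.
apply/designated_proj; apply: (H reduction erefl (fun t => proj (h t))).
  by move=> f x; rewrite hh proj_is_hom.
by move=> _ [t Gt <-]; apply/designated_proj; apply: hG; exists t.
Qed.

(** The designated set is itself a deductive filter, so elements whose polynomial images generate
    the same filters have Leibniz equivalent representatives. *)
Lemma reduction_in_Alg (D : logic L) :
  (forall Gamma phi, D Gamma phi -> matrix_consequence (eq m) Gamma phi) ->
  Alg D reduction.
Proof.
move=> mD.
have filt : @deductive_filter L D reduction (@designated L reduction).
  move=> Gamma phi /mD/reduction_consequence H h hh.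
  exact: H.
have step a c (t : Fm L) (e : nat -> m) :
    let p b := eval (fun n => if n == 0 then b else e n) t in
    filter_equiv D (proj a : reduction) (proj c) ->
    designated (p a) -> designated (p c).
  move=> p ac.
  pose q (b : reduction) : reduction :=
    eval (fun n => if n == 0 then b else proj (e n)) t.
  have pq b : proj (p b) = q (proj b).
    by rewrite /p proj_eval; apply: (@eq_eval _ reduction) => n; case: ifP.
  have qp : unary_polynomial q by exists t, (fun n => proj (e n)).
  rewrite -designated_proj -[designated (p c)]designated_proj => pa.
  have : Fg D [set q (proj c)] (q (proj c)) by move=> F [_]; apply.
  rewrite -(ac q qp) -!pq; apply; split => //.
  by move=> _ ->.
move=> a c; rewrite -(creprK a) -(creprK c) => ac; apply/proj_eq => p [t [e pE]].
rewrite !pE; split; apply: step => // q qp; exact/esym/ac.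
Qed.

End Reduction.

(** * Reduced matrix semantics and the class [Alg] *)

Definition reductions (L : language) (M : matrix L -> Prop) : matrix L -> Prop :=
  fun m' => exists2 m, M m & m' = reduction m.

Section Semantics.
Variables (L : language) (D : logic L).
Implicit Types M : matrix L -> Prop.

Lemma matrix_consequence_each M Gamma phi :
  matrix_consequence M Gamma phi <->
  forall m, M m -> matrix_consequence (eq m) Gamma phi.
Proof.
split=> H; first by move=> m Mm _ <-; exact: (H m Mm).
by move=> m Mm; exact: (H m Mm m erefl).
Qed.

Lemma reductions_semantics M :
  matrix_semantics D M -> matrix_semantics D (reductions M).
Proof.
move=> DM Gamma phi; rewrite (DM _ _) !matrix_consequence_each.
split=> H m; first by case=> m' Mm' ->; apply/(reduction_consequence m')/H.
by move=> Mm; apply/(reduction_consequence m)/H; exists m.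
Qed.

Definition theory (T : set (Fm L)) : Prop := forall phi, D T phi -> T phi.

Lemma theory_closure (Gamma : set (Fm L)) : theory (D Gamma).
Proof. by move=> phi; apply: entails_cut. Qed.

Definition lindenbaum : matrix L -> Prop :=
  fun m => exists2 T, theory T & m = @Matrix L (FmAlg L) T.

Lemma lindenbaum_semantics : matrix_semantics D lindenbaum.
Proof.
move=> Gamma phi; split=> [Dphi _ [T thT ->] h hh hG|H].
  apply: thT; apply: entails_cut (entails_subst hh Dphi) => t /hG.
  exact: entails_refl.
apply: (H (@Matrix L (FmAlg L) (D Gamma)) _ id) => //.
  by exists (D Gamma) => //; apply: theory_closure.
by move=> _ [t Gt <-]; apply: entails_refl.
Qed.

Lemma reductions_in_Alg M m :
  matrix_semantics D M -> reductions M m -> Alg D m.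
Proof.
move=> DM [m' Mm' ->]; apply: reduction_in_Alg => Gamma phi /DM.
by move/matrix_consequence_each; apply.
Qed.

Lemma validates_term_fun (A : algebra L) eps delta :
  validates A eps delta -> forall a : A, term_fun eps a = term_fun delta a.
Proof. by move=> v a; apply: v; apply: eval_is_hom. Qed.

Lemma validates_logically_equivalent M eps delta :
  matrix_semantics D M -> (forall m, M m -> validates m eps delta) ->
  logically_equivalent D eps delta.
Proof.
move=> DM val gamma v.
have E (m : matrix L) (h : Fm L -> m) : M m -> @is_hom L (FmAlg L) m h ->
    h (subst1 v eps gamma) = h (subst1 v delta gamma).
  move=> Mm hh; rewrite !(hom_eval hh (subst1 _ _ _)) !eval_subst1.
  by rewrite -!(hom_eval hh) (val m Mm h hh).
by split; apply/DM => m Mm h hh hG; [rewrite -E|rewrite E] => //; apply: hG;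
  apply: imageP.
Qed.

(** Logical equivalence, applied to the term of a polynomial p, puts p(h eps) and p(h delta) into
    the same filters. *)
Lemma Alg_validates eps delta (A : algebra L) :
  vars eps `<=` [set 0] -> vars delta `<=` [set 0] ->
  logically_equivalent D eps delta -> Alg D A -> validates A eps delta.
Proof.
move=> ve vd eqv algA h hh; apply: algA => p [t [e pE]].
(* Variable 1 takes the place of the argument of the polynomial, so that the
   variable 0 of [eps] and [delta] is not captured. *)
pose gamma := @eval L (FmAlg L) (fun n => Var n.+1) t.
pose e' n := if n is k.+1 then e k else h (Var 0).
have E u : vars u `<=` [set 0] -> eval e' (subst1 1 u gamma) = p (h u).
  move=> vu; rewrite eval_subst1 eval_comp pE; apply: eq_eval => -[|n] //=.
  rewrite (hom_eval hh); apply: eq_in_eval => n /vu.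
  by move=> /= ->.
have sub u w : vars u `<=` [set 0] -> vars w `<=` [set 0] ->
    D [set subst1 1 u gamma] (subst1 1 w gamma) ->
    Fg D [set p (h w)] `<=` Fg D [set p (h u)].
  move=> vu vw duw a Fa F [filF Fu]; apply: Fa; split=> // _ ->.
  rewrite -E //; apply: (filF _ _ duw); first exact: eval_is_hom.
  by move=> _ [_ -> <-]; rewrite E //; apply: Fu.
have [d1 d2] := eqv gamma 1.
by apply/seteqP; split; apply: sub.
Qed.

(** * Algebraic semantics as matrix semantics *)

Definition solutions (tau : set (equation L)) (A : algebra L) : set A :=
  [set a | forall e, tau e -> term_fun e.1 a = term_fun e.2 a].

Lemma solutions_hom (tau : set (equation L)) (A : algebra L) (h : Fm L -> A) t :
  (forall e, tau e -> vars e.1 `|` vars e.2 `<=` [set 0]) ->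
  @is_hom L (FmAlg L) A h ->
  solutions tau (h t) <-> forall e, instance tau t e -> h e.1 = h e.2.
Proof.
move=> vt hh.
have E u : vars u `<=` [set 0] -> h (subst1 0 t u) = term_fun u (h t).
  move=> vu; rewrite (hom_eval hh) eval_subst1; apply: eq_in_eval => n /vu -> /=.
  by rewrite -hom_eval.
split=> [st _ [e te <-] /=|H e te].
  by have := vt e te; rewrite subUset => -[v1 v2]; rewrite !E //; apply: st.
have := vt e te; rewrite subUset => -[v1 v2]; rewrite -!E //.
by apply: (H (_, _)); exists e.
Qed.

Lemma algebraic_semanticsP :
  has_algebraic_semantics D <->
  exists (tau : set (equation L)) (M : matrix L -> Prop),
    [/\ forall e, tau e -> vars e.1 `|` vars e.2 `<=` [set 0],
        matrix_semantics D M &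
        forall m, M m -> @designated L m = @solutions tau m].
Proof.
split=> [[tau [K [vt HK]]]|[tau [M [vt DM HM]]]].
  exists tau, (fun m : matrix L => K m /\ @designated L m = @solutions tau m).
  split=> // [|m []//] Gamma phi; rewrite HK; split=> H.
    move=> m [Km ->] h hh hG; apply/solutions_hom => // e te.
    apply: (H e te m Km h hh) => e' [t Gt]; move: e'.
    by apply/(solutions_hom t vt hh); apply: hG; exists t.
  move=> e te A KA h hh hG.
  have := H (Matrix (@solutions tau A)) (conj KA erefl) h hh.
  rewrite [designated _](solutions_hom phi vt hh); apply=> // _ [t Gt <-].
  apply/(solutions_hom t vt hh) => e' te'.
  by apply: hG; exists t.
exists tau, (fun A => M (Matrix (@solutions tau A))); split=> // Gamma phi.
rewrite (DM _ _); split=> H.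
  move=> e te A MA h hh hG; move: e te.
  apply/(solutions_hom phi vt hh).
  apply: (H _ MA h hh) => _ [t Gt <-].
  apply/(solutions_hom t vt hh) => e' te'.
  by apply: hG; exists t.
move=> m Mm; have dm := HM m Mm; move: m dm Mm => [A F] /= -> Mm h hh hG.
apply/(solutions_hom phi vt hh) => e te.
apply: (H e te A Mm h hh) => e' [t Gt]; move: e'.
by apply/(solutions_hom t vt hh); apply: hG; exists t.
Qed.

(** The defining equation is x = psi(x): where psi is constant with value c, its only solution is
    c. *)
Lemma assertional_algebraic : assertional D -> has_algebraic_semantics D.
Proof.
move=> [M [DM [psi [vpsi HM]]]]; apply/algebraic_semanticsP.
exists [set (Var 0, psi)], M; split=> // [_ -> /=|m Mm]; first by rewrite subUset; split.
have [c [cE ->]] := HM m Mm; apply/seteqP; split=> [_ -> _ -> /=|a].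
  by rewrite cE.
by move/(_ _ erefl) => /=; rewrite cE.
Qed.

End Semantics.

(** * Graph-based logics *)

Section GraphBased.
Variable L : language.

(** Terms are chains of the unary connective. A chain ending in variable 0 gives a power of its
    operation U; any other end gives a constant. *)
Lemma graph_based_term (A : algebra L) : graph_based L ->
  exists U : A -> A, forall (e : nat -> A) (t : Fm L),
    let p a := eval (fun n => if n == 0 then a else e n) t in
    (exists c, forall a, p a = c) \/ (exists k, forall a, p a = iter k U a).
Proof.
move=> [ar1 uniqf].
have [U UE] : exists U : A -> A, forall f : symb L, arity f = 1 ->
    forall x : 'I_(arity f) -> A, forall i, interp f x = U (x i).
  have [[f f1]|nf] := pselect (exists f : symb L, arity f = 1); last first.
    by exists id => f f1; case: nf; exists f.
  exists (fun a => interp f (fun _ => a)) => g g1.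
  rewrite (uniqf _ _ g1 f1) => x i; congr interp; apply: funext => j.
  by congr x; apply: val_inj; move: (ltn_ord i) (ltn_ord j) f1 => /=; lia.
exists U => e; elim=> [n|f args IH] /=.
  by case: eqVneq => [_|n0]; [right; exists 0|left; exists (e n)].
have := ar1 f; rewrite leq_eqVlt => /orP[/eqP f1|]; last first.
  rewrite ltnS leqn0 => /eqP f0; left.
  have [a0] := carrier_nonempty A.
  exists (interp f (fun _ => a0)) => a; congr interp; apply: funext => i.
  by have := ltn_ord i; lia.
have i0 : 'I_(arity f) by rewrite f1; apply: ord0.
have [[c cE]|[k kE]] := IH i0.
  by left; exists (U c) => a; rewrite (UE _ f1 _ i0) cE.
by right; exists k.+1 => a; rewrite (UE _ f1 _ i0) kE.
Qed.

Lemma solutions_polynomial (tau : set (equation L)) (A : algebra L)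
    (a b : A) (p : A -> A) :
  graph_based L ->
  (forall e, tau e -> vars e.1 `|` vars e.2 `<=` [set 0]) ->
  unary_polynomial p ->
  solutions tau a -> solutions tau b -> solutions tau (p a) ->
  solutions tau (p b).
Proof.
move=> gb vt [t [e0 pE]] sa sb.
have [U UE] := graph_based_term A gb.
have TE u : vars u `<=` [set 0] ->
    (exists c : A, forall d, term_fun u d = c) \/
    (exists k, forall d, term_fun u d = iter k U d).
  move=> vu.
  have E (d : A) : term_fun u d = eval (fun n => if n == 0 then d else b) u.
    by apply: eq_in_eval => n /vu ->.
  case: (UE (fun _ => b) u) => -[c cE]; [left|right]; exists c => d;
    by rewrite E cE.
case: (UE e0 t) => -[k kE]; first by rewrite !pE !kE.
have {}pE d : p d = iter k U d by rewrite pE kE.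
rewrite !pE => spa e te.
have := vt e te; rewrite subUset => -[v1 v2].
have com i d : iter i U (iter k U d) = iter k U (iter i U d).
  by rewrite -!iterD addnC.
have := sa e te; have := sb e te; have := spa e te.
have [[c1 E1]|[i E1]] := TE _ v1; have [[c2 E2]|[j E2]] := TE _ v2;
  rewrite ?E1 ?E2 ?com //.
(* If one side is a constant c, the equations at a and at p(a) give c = U^k(c), which is what the
   equation at p(b) requires. *)
- by move=> pa' b' a'; rewrite -b' {1}pa' -a'.
- by move=> pa' b' a'; rewrite b' -{2}pa' a'.
- by move=> _ ->.
Qed.

Lemma graph_based_assertional (D : logic L) (phi : Fm L) :
  graph_based L -> theorem D phi -> has_algebraic_semantics D ->
  assertional D.
Proof.
move=> gb thm /algebraic_semanticsP[tau [M [vt DM HM]]].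
exists (reductions M); split; first exact: reductions_semantics.
(* All variables of the theorem are identified with x; its values are always designated. *)
exists (plug phi (Var 0)); split; first exact: vars_plug_sub.
move=> _ [m Mm ->].
have des (a : m) : designated (term_fun phi a).
  apply: (iffLR (DM _ _) thm m Mm); first exact: eval_is_hom.
  by move=> _ [? []].
have desr (X : reduction m) : designated (term_fun (plug phi (Var 0)) X).
  rewrite {1}/term_fun eval_plug /= -(creprK X) -[term_fun _ _]proj_eval.
  exact/designated_proj/des.
(* Polynomials do not separate solutions, so the reduction identifies them. *)
have one (X Y : reduction m) : designated X -> designated Y -> X = Y.
  rewrite -(creprK X) -(creprK Y) !designated_proj HM // => sX sY.
  apply/proj_eq => p pp; rewrite HM //.
  by split; apply: solutions_polynomial.
have [X0] := carrier_nonempty (reduction m).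
exists (term_fun (plug phi (Var 0)) X0); split=> [X|]; first exact: one.
by apply/seteqP; split=> [X dX|_ ->//]; apply: one.
Qed.

End GraphBased.

(** * Two equivalent formulas in one variable *)

Lemma equivalent_formulas (L : language) (D : logic L) (phi : Fm L) :
  ~ trivial D -> theorem D phi -> vars phi <> set0 ->
  has_algebraic_semantics D ->
  exists eps delta : Fm L,
    [/\ eps <> delta,
        logically_equivalent D eps delta &
        vars eps `|` vars delta = [set 0]].
Proof.
move=> ntr thm /eqP/set0P vphi /algebraic_semanticsP[tau [M [vt DM HM]]].
have [[e1 e2] [te ne]] : exists e : equation L,
    [/\ tau e, e.1 <> e.2 & vars e.1 `|` vars e.2 !=set0].
  (* Otherwise each equation of tau is an identity or closed, so it is solved by all elements or by
     none, and x entails y. *)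
  apply: contrapT => none; apply: ntr; apply/DM => m Mm h hh.
  rewrite HM // => h0 e te.
  have /h0/(_ e te) : [set h x | x in [set Var 0]] (h (Var 0)) by exists (Var 0).
  have [->//|ne] := pselect (e.1 = e.2).
  have [v0|/set0P v] := eqVneq (vars e.1 `|` vars e.2) set0; last first.
    by case: none; exists e.
  have [v1 v2] : vars e.1 = set0 /\ vars e.2 = set0.
    by split; rewrite -subset0 -v0; [apply: subsetUl|apply: subsetUr].
  have cst u : vars u = set0 -> term_fun u (h (Var 0)) = term_fun u (h (Var 1)).
    by move=> vu; apply: eq_in_eval => n; rewrite vu.
  by rewrite !cst.
move=> /= v12; have := vt _ te; rewrite subUset /= => -[v1 v2].
pose phi0 := plug phi (Var 0).
have vphi0 : vars phi0 = [set 0] by rewrite vars_plug.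
exists (plug e1 phi0), (plug e2 phi0); split.
(* Since [phi0] contains x, no closed formula equals it and [plug_injl] applies. *)
- apply: contra_not ne => /(plug_injl (N := maxn (height e1) (height e2))).
  apply=> //; [|exact: leq_maxl|exact: leq_maxr].
  by move=> u u0 _ E; move: u0; rewrite E vphi0 => /seteqP[/(_ 0 erefl)].
- apply: (validates_logically_equivalent DM) => m Mm h hh.
  rewrite !(hom_eval hh) !eval_plug.
  have : @solutions L tau m (term_fun phi (h (Var 0))).
    rewrite -HM //; apply: (iffLR (DM _ _) thm m Mm).
      exact: eval_is_hom.
    by move=> _ [? []].
  by move/(_ _ te).
- apply/seteqP; split.
    by rewrite subUset -vphi0; split; apply: vars_plug_sub.
  by case: v12 => n [n1|n2] _ ->; [left|right]; rewrite vars_plug ?vphi0 //;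
    exists n.
Qed.

(** * Collapsing a non-overlapping equation *)

Section Collapse.
Variables (L : language) (D : logic L) (M : matrix L -> Prop).
Hypothesis DM : matrix_semantics D M.
Variables eps delta : Fm L.
Implicit Types (t u b : Fm L) (T : set (Fm L)).

(** As for critical pairs in rewriting, the variables of t and eps are taken apart, hence the
    independent b and b'. *)
Fixpoint avoids t : Prop :=
  match t with
  | Var _ => True
  | App f args =>
      (forall b b', plug t b <> plug eps b') /\ forall i, avoids (args i)
  end.

Hypothesis eps_args : if eps is App f args then forall i, avoids (args i)
                      else False.
Hypothesis delta_avoids : avoids delta.
Hypothesis delta_nvar : ~~ is_var delta.
Hypothesis eps_vars : vars eps !=set0.
Hypothesis ed_vars : vars eps `|` vars delta `<=` [set 0].
Hypothesis ed_M : forall m, M m -> forall a : m, term_fun eps a = term_fun delta a.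

(** The rewriting step from eps(b) to delta(b) at the root, allowed only for b in T. *)
Definition collapse T u : Fm L :=
  if pselect (exists2 b, T b & u = plug eps b) is left H
  then plug delta (s2val (cid2 H)) else u.

Lemma collapse_id T u : (forall b, u <> plug eps b) -> collapse T u = u.
Proof. by rewrite /collapse; case: pselect => // H ne; have [b _ /ne] := H. Qed.

Lemma collapse_eps T b :
  collapse T (plug eps b) = if pselect (T b) then plug delta b else plug eps b.
Proof.
rewrite /collapse; case: pselect => [H|nH].
  case: cid2 => c /= Tc /(plug_injr eps_vars) bc.
  by rewrite bc; case: pselect.
by case: pselect => // Tb; case: nH; exists b.
Qed.

Definition collapse_algebra T : algebra L :=
  @Algebra L (Fm L) (fun f x => collapse T (App f x)) (inhabits (Var 0)).

(** Evaluation builds [plug t b] upwards from copies of b, and no formula formed on the way is an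
    instance of eps. *)
Lemma term_fun_avoids T t b :
  avoids t -> @term_fun L (collapse_algebra T) t b = plug t b.
Proof.
rewrite /term_fun; elim: t => [n //|f args IH] /= [tne av].
rewrite (_ : (fun i => _) = fun i => plug (args i) b).
  by apply: collapse_id => c; apply: tne.
by apply: funext => i; apply: IH.
Qed.

(** The arguments of eps avoid eps, so only the outermost operation can rewrite. *)
Lemma term_fun_eps T b :
  @term_fun L (collapse_algebra T) eps b = collapse T (plug eps b).
Proof.
case E : eps eps_args => [//|f args] av; rewrite -E /term_fun.
rewrite {1}E /= (_ : (fun i => _) = fun i => plug (args i) b) ?E //.
by apply: funext => i; apply: term_fun_avoids.
Qed.

Lemma delta_neq b : plug delta b <> plug eps b.
Proof. by move: delta_avoids delta_nvar; case: delta => [//|f args] []. Qed.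

(** The value of eps at b is rewritten to that of delta exactly when b is in T; otherwise the two
    differ by [delta_neq]. *)
Lemma solutions_collapse T :
  T = @solutions L [set (eps, delta)] (collapse_algebra T).
Proof.
apply/seteqP; split=> b.
  move=> Tb _ -> /=; rewrite term_fun_eps term_fun_avoids // collapse_eps.
  by case: pselect.
move/(_ _ erefl) => /=; rewrite term_fun_eps term_fun_avoids // collapse_eps.
by case: pselect => // _ /esym/delta_neq.
Qed.

Definition interchangeable u v : Prop :=
  forall m, M m -> forall g : nat -> m, eval g u = eval g v.

Lemma interchangeable_collapse T u : interchangeable (collapse T u) u.
Proof.
rewrite /collapse; case: pselect => [H|//].
by case: cid2 => b /= _ -> m Mm g; rewrite !eval_plug ed_M.
Qed.

Lemma interchangeable_theory T u v :
  theory D T -> interchangeable u v -> T u <-> T v.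
Proof.
have sub x y : theory D T -> interchangeable x y -> T x -> T y.
  move=> thT xy Tx; apply: thT.
  apply: (@entails_cut _ _ _ [set x]).
    by move=> _ ->; apply: entails_refl.
  apply/DM => m Mm h hh; rewrite [h y](hom_eval hh) -(xy m Mm) -(hom_eval hh).
  by apply; exists x.
by move=> thT uv; split; apply: sub => // m Mm g; rewrite uv.
Qed.

Lemma interchangeable_hom T (h : Fm L -> collapse_algebra T) t :
  @is_hom L (FmAlg L) (collapse_algebra T) h ->
  interchangeable (h t) (@eval L (FmAlg L) (fun n => h (Var n)) t).
Proof.
move=> hh; elim: t => [n //|f args IH] m Mm g.
rewrite (hh f args) [LHS](@interchangeable_collapse T _ m Mm) /=.
by congr interp; apply: funext => i; apply: IH.
Qed.

(* [collapse_algebra T] maps to the algebra of formulas modulo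
   interchangeability, and this map reflects [T]. *)
Lemma collapse_semantics :
  matrix_semantics D
    (fun m => exists2 T, theory D T & m = @Matrix L (collapse_algebra T) T).
Proof.
move=> Gamma phi; split=> [Dphi _ [T thT ->] h hh hG /=|H].
  apply/(interchangeable_theory thT (interchangeable_hom phi hh)).
  pose s : Fm L -> Fm L := @eval L (FmAlg L) (fun n => h (Var n)).
  apply: (thT); apply: (@entails_cut _ _ _ (s @` Gamma)).
    move=> _ [t Gt <-]; apply: entails_refl.
    apply/(interchangeable_theory thT (interchangeable_hom t hh)).
    by apply: hG; exists t.
  exact: entails_subst.
(* The homomorphism fixing the variables moves formulas only up to interchangeability, so it pulls
   the theory [D Gamma] back to itself. *)
pose A := collapse_algebra (D Gamma).
have th := @theory_closure L D Gamma.
pose h : Fm L -> A := @eval L A Var.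
have hE t : D Gamma (h t) <-> D Gamma t.
  have := interchangeable_theory th (@interchangeable_hom _ h t _).
  by rewrite eval_Var; apply; apply: eval_is_hom.
apply/hE; apply: (H (@Matrix L A (D Gamma)) _ h).
- by exists (D Gamma).
- exact: eval_is_hom.
- by move=> _ [t Gt <-]; apply/hE; apply: entails_refl.
Qed.

Lemma collapse_algebraic : has_algebraic_semantics D.
Proof.
apply/algebraic_semanticsP; exists [set (eps, delta)].
exists (fun m => exists2 T, theory D T & m = @Matrix L (collapse_algebra T) T).
split=> [_ ->//||_ [T _ ->]]; first exact: collapse_semantics.
exact: solutions_collapse.
Qed.

End Collapse.

(** * Languages with a connective of arity at least two *)

Section Binary.
Variables (L : language) (f : symb L).
Hypothesis f2 : 1 < arity f.
Implicit Types (t u b : Fm L).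

(** Repeating v in all later arguments makes f behave as a binary connective. *)
Definition bin u v : Fm L := App f (fun i => if val i == 0 then u else v).

Lemma bin_inj u v u' v' : bin u v = bin u' v' -> u = u' /\ v = v'.
Proof.
move=> E; split; first exact: (App_inj E (Ordinal (ltnW f2))).
exact: (App_inj E (Ordinal f2)).
Qed.

Lemma plug_bin u v b : plug (bin u v) b = bin (plug u b) (plug v b).
Proof. by congr App; apply: funext => i; case: ifP. Qed.

Lemma vars_bin u v : vars (bin u v) = vars u `|` vars v.
Proof.
apply/seteqP; split=> n.
  by case=> i _; case: ifP => _ ?; [left|right].
by case=> ?; [exists (Ordinal (ltnW f2))|exists (Ordinal f2)].
Qed.

Lemma height_bin u v : height (bin u v) = (maxn (height u) (height v)).+1.
Proof.
apply/eqP; rewrite eqn_leq; apply/andP; split.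
  by apply: height_App_le => i; case: ifP => _; [apply: leq_maxl|apply: leq_maxr].
rewrite gtn_max; apply/andP; split.
  exact: (@height_arg L f (fun i => if val i == 0 then u else v)
            (Ordinal (ltnW f2))).
exact: (@height_arg L f (fun i => if val i == 0 then u else v) (Ordinal f2)).
Qed.

Fixpoint tree k : Fm L := if k is k'.+1 then bin (tree k') (tree k') else Var 0.

Lemma vars_tree k : vars (tree k) = [set 0].
Proof. by elim: k => [//|k IH]; rewrite vars_bin IH setUid. Qed.

Lemma height_tree k b : height (plug (tree k) b) = k + height b.
Proof. by elim: k => [//|k IH]; rewrite plug_bin height_bin IH maxnn. Qed.

Variables e d : Fm L.
Hypothesis vars_ed : vars e `|` vars d `<=` [set 0].
Hypothesis ed_height : height d <= height e.
Hypothesis ed_neq : forall b, plug e b <> plug d b.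

(** The estimate in [avoids_low] spends the height of e twice: on a subformula of t and on the
    context e around b'. *)
Let H := (height e).*2.+1.
Let eps := bin e (tree H).
Let delta := bin d (tree H).

Lemma plug_eps b : plug eps b = bin (plug e b) (plug (tree H) b).
Proof. exact: plug_bin. Qed.

(* If [plug t b = plug eps b'], then the second argument [tree H] makes [b]
   higher than [plug e b'], which contains [b] or is as low as a subformula
   of [t]. *)
Lemma avoids_low t : height t <= height e -> avoids eps t.
Proof.
elim: t => [//|g args IH] ht; split; last first.
  by move=> i; apply: IH; apply: leq_trans ht; apply/ltnW/height_arg.
move=> b b' E.
have [gf] : Some g = Some f by have := congr1 (@root_symb L) E.
move: args ht {IH} E; rewrite gf => args ht; rewrite plug_eps => E.
pose i0 := Ordinal (ltnW f2); pose i1 := Ordinal f2.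
have E0 : plug (args i0) b = plug e b' := App_inj E i0.
have E1 : plug (args i1) b = plug (tree H) b' := App_inj E i1.
have h0 := height_arg args i0; have h1 := height_arg args i1.
have := height_plug_le (args i1) b; rewrite E1 height_tree.
have := height_plug_le e b'; have := height_le_plug e b'.
have [c|v] := vars0_or (args i0).
  by rewrite -E0 plug_closed //; lia.
by have := height_plug_ge b v; rewrite E0 /H; lia.
Qed.

(** The first two arguments at a node of the tree coincide, while those of an instance of eps have
    different heights. *)
Lemma avoids_tree k : avoids eps (tree k).
Proof.
elim: k => [//|k IH]; split; last by move=> i; case: ifP.
move=> b b'; rewrite plug_eps [plug _ b]plug_bin => /bin_inj[-> /(congr1 (@height L))].
by rewrite height_tree; have := height_plug_le e b'; rewrite /H; lia.
Qed.

(** At the root, equal second arguments force b = b', and then [ed_neq] applies. *)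
Lemma avoids_delta : avoids eps delta.
Proof.
split; last by move=> i; case: ifP => _; [apply: avoids_low|apply: avoids_tree].
move=> b b'; rewrite plug_eps [plug _ b]plug_bin => /bin_inj[+ /plug_injr bb'].
by rewrite bb' ?vars_tree; [move/esym/ed_neq|exists 0].
Qed.

Lemma binary_algebraic_aux (D : logic L) (M : matrix L -> Prop) :
  matrix_semantics D M ->
  (forall m, M m -> forall a : m, term_fun e a = term_fun d a) ->
  has_algebraic_semantics D.
Proof.
move=> DM edM; apply: (@collapse_algebraic L D M DM eps delta) => //.
- by move=> i; case: ifP => _; [apply: avoids_low|apply: avoids_tree].
- exact: avoids_delta.
- by exists 0; rewrite vars_bin vars_tree; right.
- move: vars_ed; rewrite !vars_bin vars_tree !subUset => -[v1 v2].
  by do !split.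
- move=> m Mm a; rewrite /term_fun /=; congr interp; apply: funext => i.
  by case: ifP => // _; apply: edM.
Qed.

End Binary.

Lemma binary_algebraic (L : language) (D : logic L) (M : matrix L -> Prop)
    (eps delta : Fm L) (f : symb L) :
  1 < arity f -> matrix_semantics D M -> eps <> delta ->
  vars eps `|` vars delta `<=` [set 0] ->
  (forall m, M m -> forall a : m, term_fun eps a = term_fun delta a) ->
  has_algebraic_semantics D.
Proof.
move=> f2 DM ne v edM.
(* Instances of s are higher than N, so [plug_injl] keeps eps(s) and delta(s) distinct at every
   b. *)
pose N := maxn (height eps) (height delta); pose s := tree f N.+1.
have sub t : vars (plug t s) `<=` [set 0].
  by apply: (subset_trans (@vars_plug_sub L t s)); rewrite vars_tree.
have sneq b : plug (plug eps s) b <> plug (plug delta s) b.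
  move: v; rewrite subUset => -[v1 v2].
  rewrite !plug_plug => /(plug_injl (N := N)) E; apply/ne/E => //.
  - move=> u _ uN uE; move: uN; rewrite uE height_tree //; lia.
  - exact: leq_maxl.
  - exact: leq_maxr.
have val m : M m -> forall a : m,
    term_fun (plug eps s) a = term_fun (plug delta s) a.
  by move=> Mm a; rewrite /term_fun !eval_plug edM.
have vs : vars (plug eps s) `|` vars (plug delta s) `<=` [set 0].
  by rewrite subUset.
have [le'|/ltnW le'] := leqP (height (plug delta s)) (height (plug eps s)).
  exact: (binary_algebraic_aux f2 vs le' sneq DM val).
apply: (binary_algebraic_aux f2 _ le' _ DM) => //.
- by rewrite setUC.
- by move=> b /esym/sneq.
- by move=> m Mm a; rewrite val.
Qed.

(** * Languages with two unary connectives *)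

Section Unary.
Variables (L : language) (f g : symb L).
Hypotheses (f1 : arity f = 1) (g1 : arity g = 1) (fg : f <> g).
Implicit Types (t u b : Fm L) (a : symb L).

Definition un a u : Fm L := App a (fun _ => u).

Lemma plug_un a u b : plug (un a u) b = un a (plug u b).
Proof. by []. Qed.

Lemma vars_un a u : arity a = 1 -> vars (un a u) = vars u.
Proof.
move=> a1; rewrite /= bigcup_const //.
by rewrite a1; exists ord0.
Qed.

Definition tower N u : Fm L := iter N (un f) u.

Lemma plug_tower N u b : plug (tower N u) b = tower N (plug u b).
Proof. by elim: N => [//|N IH]; rewrite /tower /= -/(tower N u) plug_un IH. Qed.

Lemma vars_tower N u : vars (tower N u) = vars u.
Proof. by elim: N => [//|N IH]; rewrite vars_un. Qed.

Lemma un_inj u v : un f u = un f v -> u = v.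
Proof.
have i : 'I_(arity f) by rewrite f1; apply: ord0.
by move/App_inj/(_ i).
Qed.

Lemma tower_inj N u v : tower N u = tower N v -> u = v.
Proof. by elim: N => [//|N IH] /un_inj. Qed.

(** A g directly above each variable stops a run of f from continuing into a substituted formula. *)
Fixpoint guarded t : Prop :=
  match t with
  | Var _ => True
  | App h args => forall i, guarded (args i) /\ (is_var (args i) -> h = g)
  end.

Lemma guarded_plug t u : guarded u -> ~~ is_var u -> guarded (plug t u).
Proof.
move=> gu nu; elim: t => [//|h args IH] i; split; first exact: IH.
by case: (args i) => //= _; rewrite (negbTE nu).
Qed.

(** The tower is at least as long as t is high, so it would have to leave t through a variable
    directly below f. *)
Lemma guarded_neq_tower t b j u :
  guarded t -> ~~ is_var t -> height t <= j -> plug t b <> tower j u.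
Proof.
elim: t j => [//|h args IH] [|j] // gt _ ht E.
have [hf] : Some h = Some f := congr1 (@root_symb L) E.
have i : 'I_(arity h) by rewrite hf f1; apply: ord0.
apply: (IH i j).
- by case: (gt i).
- by apply/negP => /(proj2 (gt i)) hg; apply: fg; rewrite -hf.
- by rewrite -ltnS; apply: leq_trans ht; apply: height_arg.
move: args i E {IH gt ht}; rewrite hf => args i E.
exact: (App_inj E i).
Qed.

Variables e d : Fm L.
Hypothesis vars_ed : vars e `|` vars d `<=` [set 0].
Hypothesis e_vars : vars e !=set0.
Hypotheses (e_guarded : guarded e) (d_guarded : guarded d).
Hypotheses (e_nvar : ~~ is_var e) (d_nvar : ~~ is_var d).
Hypothesis ed_neq : forall b b', plug e b <> plug d b'.

(** The successor accounts for the g placed above e and d. *)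
Let N := (maxn (height e) (height d)).+1.
Let eps := tower N (un g e).
Let delta := tower N (un g d).

Lemma avoids_guarded t : guarded t -> height t <= N -> avoids eps t.
Proof.
elim: t => [//|h args IH] gt ht; split.
  by move=> b b'; rewrite plug_tower; apply: guarded_neq_tower.
move=> i; apply: IH; first by case: (gt i).
by apply: leq_trans ht; apply/ltnW/height_arg.
Qed.

Lemma guarded_un u : guarded u -> guarded (un g u).
Proof. by move=> gu i; split. Qed.

Lemma height_un a u : height (un a u) <= (height u).+1.
Proof. exact: height_App_le. Qed.

(** Since k < N, cancelling the leading f leaves g at the root on one side and f on the other. *)
Lemma avoids_tower k u :
  k < N -> guarded u -> height u <= N.-1 -> avoids eps (tower k (un g u)).
Proof.
move=> kN gu hu; elim: k kN => [|k IH] kN.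
  apply: avoids_guarded; first exact: guarded_un.
  exact: leq_trans (height_un _ _) _.
split; last by move=> _; apply/IH/ltnW.
have [j Nj] : exists j, N = k.+1 + j.+1 by exists (N - k.+2); lia.
move=> b b'; rewrite [plug _ b](plug_tower k.+1) plug_tower Nj.
rewrite [RHS]iterD => E; have := @tower_inj k.+1 _ _ E.
by move/(congr1 (@root_symb L)) => -[/esym].
Qed.

(** Cancelling the towers does not relate b to b', hence the form of [ed_neq] with independent
    arguments. *)
Lemma avoids_delta_unary : avoids eps delta.
Proof.
split; last by move=> i; apply: avoids_tower => //; rewrite leq_maxr.
move=> b b'; rewrite [plug _ b](plug_tower N) plug_tower => /tower_inj.
have i : 'I_(arity g) by rewrite g1; apply: ord0.
by move/App_inj/(_ i)/esym/ed_neq.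
Qed.

Lemma unary_algebraic_aux (D : logic L) (M : matrix L -> Prop) :
  matrix_semantics D M ->
  (forall m, M m -> forall a : m, term_fun e a = term_fun d a) ->
  has_algebraic_semantics D.
Proof.
move=> DM edM; apply: (@collapse_algebraic L D M DM eps delta) => //.
- by move=> i; apply: avoids_tower => //; rewrite leq_maxl.
- exact: avoids_delta_unary.
- by rewrite vars_tower vars_un.
- by rewrite !vars_tower !vars_un.
- move=> m Mm a; rewrite /eps /delta /term_fun /tower.
  elim: N => [|n IH] /=; congr interp; apply: funext => _ //.
  exact: edM.
Qed.

End Unary.

(* Where one formula has a variable and the other one does not, the substitute
   is chosen with a different leading connective. *)
Lemma separating_substitution (L : language) (f g : symb L) (t t' : Fm L) :
  f <> g -> vars t `<=` [set 0] -> vars t' `<=` [set 0] -> t <> t' ->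
  exists2 a, a = f \/ a = g & forall u b b',
    plug (plug t (un a u)) b <> plug (plug t' (un a u)) b'.
Proof.
move=> fg; have choose h : exists2 a, a = f \/ a = g & a <> h.
  have [fh|fh] := pselect (f = h); last by exists f; [left|].
  by exists g; [right|rewrite -fh; apply: nesym].
elim: t t' => [n|h args IH] [n'|h' args'] vt vt' ne.
- by case: ne; have -> : n = 0 := vt n erefl; have -> : n' = 0 := vt' n' erefl.
- have [a afg ah] := choose h'; exists a => // u b b'.
  by move/(congr1 (@root_symb L)) => -[].
- have [a afg ah] := choose h; exists a => // u b b'.
  by move/(congr1 (@root_symb L)) => -[/esym].
have [hh'|hh'] := pselect (h = h'); last first.
  by exists f; [left|move=> u b b' /(congr1 (@root_symb L)) -[]].
move: args' vt' ne; rewrite -hh' => args' vt' ne.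
have [i nei] : exists i, args i <> args' i.
  by apply: contrapT => /forallNP E; apply: ne; congr App; apply: funext => i;
    apply: contrapT (E i).
have [||//|a afg sep] := IH i (args' i).
- by move=> n ni; apply: vt; exists i.
- by move=> n ni; apply: vt'; exists i.
by exists a => // u b b' /App_inj/(_ i); apply: sep.
Qed.

Lemma unary_algebraic (L : language) (D : logic L) (M : matrix L -> Prop)
    (eps delta : Fm L) (f g : symb L) :
  arity f = 1 -> arity g = 1 -> f <> g -> matrix_semantics D M ->
  eps <> delta -> vars eps `|` vars delta = [set 0] ->
  (forall m, M m -> forall a : m, term_fun eps a = term_fun delta a) ->
  has_algebraic_semantics D.
Proof.
move=> f1 g1 fg DM.
wlog : eps delta / vars eps !=set0 => [th|ve ne v edM].
  move=> ne v edM; have [e0|ve] := vars0_or eps; last exact: (th eps delta).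
  apply: (th delta eps) => //; last by move=> m Mm a; rewrite edM.
  - by exists 0; rewrite -[vars delta]set0U -e0 v.
  - exact: nesym.
  - by rewrite setUC.
have [v1 v2] : vars eps `<=` [set 0] /\ vars delta `<=` [set 0].
  by split; rewrite -v; [apply: subsetUl|apply: subsetUr].
have [a afg sep] := separating_substitution fg v1 v2 ne.
have a1 : arity a = 1 by case: afg => ->.
(* The outer a separates the two formulas; the inner g guards the variable. *)
pose s : Fm L := un a (un g (Var 0)).
have vs : vars s = [set 0] by rewrite !vars_un.
have gs : guarded g s by [].
have nvar t : ~~ is_var (plug t s) by case: t.
apply: (@unary_algebraic_aux L f g f1 g1 fg (plug eps s) (plug delta s)) DM _ => //.
- by rewrite -vs subUset; split; apply: vars_plug_sub.
- by rewrite vars_plug // vs; exists 0.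
- exact: guarded_plug.
- exact: guarded_plug.
- by move=> b b'; apply: sep.
- by move=> m Mm c; rewrite /term_fun !eval_plug edM.
Qed.

(** * The four equivalent conditions *)

Lemma not_graph_basedP (L : language) :
  ~ graph_based L ->
  (exists f : symb L, 1 < arity f) \/
  (exists f g : symb L, [/\ arity f = 1, arity g = 1 & f <> g]).
Proof.
move=> ngb; apply: contrapT => /not_orP[n2 n1]; apply: ngb; split=> [f|f g f1 g1].
  by rewrite leqNgt; apply/negP => f2; apply: n2; exists f.
by apply: contrapT => fg; apply: n1; exists f, g.
Qed.

Theorem theorem8p1 (L : language) (D : logic L) (phi : Fm L)
    (hnontrivial : ~ trivial D)
    (htheorem : theorem D phi)
    (hvars : vars phi <> set0) :
  [<-> has_algebraic_semantics D;

       (assertional D /\ graph_based L) \/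
       (~ graph_based L /\
        exists eps delta : Fm L,
          [/\ eps <> delta,
              logically_equivalent D eps delta &
              vars eps `|` vars delta = [set 0]]);

       (assertional D /\ graph_based L) \/
       (~ graph_based L /\
        exists eps delta : Fm L,
          [/\ eps <> delta,
              vars eps `|` vars delta = [set 0] &
              forall A : algebra L, Alg D A -> validates A eps delta]);

       (assertional D /\ graph_based L) \/
       (~ graph_based L /\
        exists (M : matrix L -> Prop) (eps delta : Fm L),
          [/\ matrix_semantics D M,
              eps <> delta,
              vars eps `|` vars delta = [set 0] &
              forall m : matrix L, M m -> validates m eps delta])].
Proof.
tfae.
- move=> alg; have [gb|ngb] := pselect (graph_based L).
    by left; split=> //; apply: graph_based_assertional htheorem alg.
  by right; split=> //; apply: equivalent_formulas htheorem hvars alg.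
- case=> [H|[ngb [eps [delta [ne eqv v]]]]]; [by left|right; split=> //].
  exists eps, delta; split=> // A; apply: Alg_validates eqv; rewrite -v.
    exact: subsetUl.
  exact: subsetUr.
- case=> [H|[ngb [eps [delta [ne v val]]]]]; [by left|right; split=> //].
  have DL := @lindenbaum_semantics L D.
  exists (reductions (lindenbaum D)), eps, delta; split=> //.
    exact: reductions_semantics.
  by move=> m rm; apply/val/(reductions_in_Alg DL rm).
- case=> [[ass _]|[ngb [M [eps [delta [DM ne v val]]]]]].
    exact: assertional_algebraic.
  have edM m (Mm : M m) := validates_term_fun (val m Mm).
  have [[f f2]|[f [g [f1 g1 fg]]]] := not_graph_basedP ngb.
    by apply: (binary_algebraic f2 DM ne _ edM); rewrite v.
  exact: (unary_algebraic f1 g1 fg DM ne v edM).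
Qed.
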